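(* Let $\alpha,k,q,\tau,\varepsilon>0$. For any network $\mathcal{G}^P$ (a connected undirected graph on $n\ge2$ nodes with edge weights $b_{ij}>0$) it holds that $$\|\mathcal{S}^{\mathrm{DAPI}}\|_2^2<\|\mathcal{S}^{\mathrm{CAPI}}\|_2^2\quad\text{if}\quad\hat\gamma<\gamma<\infty,$$ where $\hat\gamma=\varepsilon^2/\lambda_2$ and $\lambda_2$ is the smallest non-zero eigenvalue of $\mathcal{L}_B$.
   Context: $\mathcal{L}_B$ is the weighted Laplacian of $\mathcal{G}^P$ with weights (susceptances) $b_{ij}=b_{ji}>0$ and has eigenvalues $0=\lambda_1<\lambda_2\le\dots\le\lambda_n$. $\|\mathcal{S}^{\mathrm{DAPI}}\|_2^2$ and $\|\mathcal{S}^{\mathrm{CAPI}}\|_2^2$ are the expected transient power losses (squared $\mathcal{H}_2$ norms) of the linearized power network with, respectively, distributed averaging (DAPI) and centralized averaging (CAPI) proportional-integral control, subject to power injection noise and frequency measurement noise. Under the standing assumptions of uniform conductance-to-susceptance ratio $\alpha$, uniform droop gain $k$, time constant $\tau$, integral gain $q$, and DAPI averaging gains $c_{ij}=\gamma b_{ij}$, $\gamma>0$, they are $$\|\mathcal{S}^{\mathrm{DAPI}}\|_2^2=\frac{\alpha}{2k}\sum_{i=2}^n\left(\frac{1}{1+\varphi(\lambda_i,\gamma,k,q,\tau)^{-1}}+\frac{\varepsilon^2}{\gamma\lambda_i}\cdot\frac{1}{1+\varphi(\lambda_i,\gamma,k,q,\tau)}\right),\qquad\|\mathcal{S}^{\mathrm{CAPI}}\|_2^2=\frac{\alpha}{2k}(n-1),$$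 where $$\varphi(\lambda_i,\gamma,k,q,\tau)=\frac{kq^2\lambda_i+q\gamma\lambda_i+\tau(\gamma\lambda_i)^2}{q+\tau\gamma\lambda_i}.$$ *)

(* Defs.v *)
From HB Require Import structures.
From mathcomp Require Import all_boot all_order all_algebra.
From mathcomp Require Import spectral complex.

Set Implicit Arguments.
Unset Strict Implicit.
Unset Printing Implicit Defensive.

Import Order.TTheory GRing.Theory Num.Theory.
Local Open Scope ring_scope.

(* A network is a graph, given by its edge relation [e], with weights [b].
   Only the values of [b] on edges are ever used. *)
Definition laplacian (R : rcfType) (n : nat) (e : rel 'I_n) (b : 'I_n -> 'I_n -> R)
    : 'M[R]_n :=
  \matrix_(i, j) if i == j then \sum_(l < n | e i l) b i l
                 else if e i j then - b i j else 0.

Definition weighted_graph (R : rcfType) (n : nat) (e : rel 'I_n)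
    (b : 'I_n -> 'I_n -> R) : Prop :=
  [/\ symmetric e, irreflexive e,
      forall i j, e i j -> b i j = b j i
    & forall i j, e i j -> 0 < b i j].

Definition connected_graph (n : nat) (e : rel 'I_n) : Prop :=
  forall i j, connect e i j.

(* [lam] lists the eigenvalues of [A] in nondecreasing order, repeated according
   to algebraic multiplicity. *)
Definition ordered_spectrum (R : rcfType) (n : nat) (A : 'M[R]_n)
    (lam : n.-tuple R) : Prop :=
  sorted <=%R lam /\ char_poly A = \prod_(x <- lam) ('X - x%:P).

(* lambda_i with the indices 1, ..., n of the mathematical notation. *)
Definition eigenvalue_nb (R : rcfType) (n : nat) (lam : n.-tuple R) (i : nat) : R :=
  lam`_i.-1.

Definition phi (R : rcfType) (l gamma k q tau : R) : R :=
  (k * q ^+ 2 * l + q * gamma * l + tau * (gamma * l) ^+ 2)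
    / (q + tau * gamma * l).

(* The squared H2 norms (expected transient losses) of the closed-loop systems,
   in closed form, under uniform parameters and averaging gains
   c_ij = gamma * b_ij. *)
Definition dapi_loss (R : rcfType) (n : nat) (lam : n.-tuple R)
    (alpha k q tau eps gamma : R) : R :=
  alpha / (2 * k) *
  \sum_(2 <= i < n.+1)
     (1 / (1 + (phi (eigenvalue_nb lam i) gamma k q tau)^-1)
      + eps ^+ 2 / (gamma * eigenvalue_nb lam i)
        * (1 / (1 + phi (eigenvalue_nb lam i) gamma k q tau))).

Definition capi_loss (R : rcfType) (n : nat) (alpha k : R) : R :=
  alpha / (2 * k) * (n%:R - 1).

(* The spectral theorem: for the Laplacian, [ordered_spectrum] is always
   realized, so quantifying over such [lam] is no restriction. *)
Lemma ordered_spectrum_exists (R : rcfType) (n : nat) (A : 'M[R]_n) :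
  A^T = A -> exists lam : n.-tuple R, ordered_spectrum A lam.
Proof.
move=> sA; pose AC : 'M[R[i]]_n := map_mx (real_complex R) A.
have hA : AC \is hermsymmx.
  apply: realsym_hermsym.
    by apply/is_hermitianmxP; rewrite expr0 scale1r map_mx_id // map_trmx sA.
  by apply/mxOverP=> i j; rewrite mxE complex_real.
have /orthomx_spectralP AE := hermitian_normalmx hA.
have /mxOverP dr := hermitian_spectral_diag_real hA.
set D := spectral_diag AC in AE dr; set P := spectralmx AC in AE.
have uP : P \in unitmx by exact: spectral_unit.
pose d := [seq complex.Re (D 0 i) | i <- enum 'I_n].
have sd : size (sort <=%R d) == n by rewrite size_sort size_map size_enum_ord.
exists (Tuple sd); split; first by rewrite /= sort_le_sorted.
apply: (@map_poly_inj _ _ (real_complex R)).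
rewrite map_char_poly -/AC /=.
have -> : \prod_(x <- sort <=%R d) ('X - x%:P) = \prod_(x <- d) ('X - x%:P).
  by apply: perm_big; rewrite perm_sort.
rewrite rmorph_prod big_map big_enum /=.
transitivity (char_poly (diag_mx D)).
  rewrite /char_poly /char_poly_mx AE !map_mxM map_invmx.
  set Q := map_mx polyC P; have uQ : Q \in unitmx by rewrite map_unitmx.
  have {1}-> : 'X%:M = invmx Q *m 'X%:M *m Q :> 'M[{poly R[i]}]_n.
    by rewrite scalar_mxC mulmxKV.
  rewrite -mulmxBl -mulmxBr !det_mulmx mulrAC -det_mulmx mulVmx //.
  by rewrite det1 mul1r.
rewrite char_poly_trig ?diag_mx_is_trig //; apply: eq_bigr => i _.
rewrite rmorphB /= map_polyX map_polyC /= mxE eqxx mulr1n.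
by congr (_ - _%:P); rewrite -[LHS]RRe_real.
Qed.

(* Main.v *)
Require Import Defs.
From mathcomp Require Import all_boot all_order all_algebra.
From mathcomp Require Import ring.

(** The loss inequality holds eigenvalue by eigenvalue.  Put [p := phi l] and
    [c := eps ^+ 2 / (gamma * l)].  When [0 < l] the [i]-th summand of the DAPI
    loss is the convex combination [(p + c) / (1 + p)] of [1] and [c], so it is
    smaller than [1] as soon as [c < 1], that is [eps ^+ 2 < gamma * l]; and the
    threshold on [gamma] says this for the smallest of the eigenvalues
    [lambda_2 <= ... <= lambda_n].  As the CAPI loss counts [1] for each of
    these [n - 1] eigenvalues, the inequality follows.

    The graph enters only through [0 < lambda_2]: the Laplacian of a connected
    weighted graph has no negative eigenvalue, and [0] is a simple root of its
    characteristic polynomial.  Both rest on the Dirichlet form: twice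
    [u *m L *m u^T] is the sum of [w i j * (u i - u j) ^+ 2], which is
    nonnegative, and vanishes only for constant [u] when the graph is connected
    ([laplacian_eigenvalue_ge0], [laplacian_ker_const]).  Since [lambda_2] counts
    algebraic multiplicity, a one-dimensional kernel alone does not settle this.
    Because [L] has zero row sums, the factor ['X] splits off
    [\det ('X - L)] explicitly ([char_poly_row_sum0]), leaving a
    determinant whose value at [0] is that of [- L] with its first column
    replaced by ones.  A row vector [u] killed by that matrix satisfies
    [u *m L = 0] and has entry sum [0]; it is constant, hence null. *)

Import Order.TTheory GRing.Theory Num.Theory.
Local Open Scope ring_scope.

(** * The Dirichlet form of a weighted graph *)

Definition edge_weight {R : rcfType} {n : nat} (e : rel 'I_n)
  (b : 'I_n -> 'I_n -> R) (i j : 'I_n) : R := if e i j then b i j else 0.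

Section Dirichlet.
Variables (R : rcfType) (n : nat) (e : rel 'I_n) (b : 'I_n -> 'I_n -> R).
Hypothesis hG : weighted_graph e b.
Local Notation w := (edge_weight e b).
Local Notation L := (laplacian e b).

Lemma edge_weight_ge0 i j : 0 <= w i j.
Proof. by case: hG => _ _ _ bpos; rewrite /edge_weight; case: ifP => // /bpos/ltW. Qed.

Lemma edge_weight_sym i j : w i j = w j i.
Proof.
case: hG => esym _ bsym _; rewrite /edge_weight (esym j i).
by case: ifP => // /bsym.
Qed.

Lemma laplacianE i j : L i j = (\sum_l w i l) *+ (i == j) - w i j.
Proof.
case: hG => _ eirr _ _; rewrite mxE /edge_weight -big_mkcond /=.
case: eqP => [<-|_]; first by rewrite eirr subr0.
by case: ifP => _; rewrite sub0r ?oppr0.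
Qed.

Lemma laplacian_row_sum0 i : \sum_j L i j = 0.
Proof.
under eq_bigr do rewrite laplacianE.
rewrite sumrB (bigD1 i) //= eqxx [X in _ + X - _]big1 ?addr0 ?subrr // => j.
by rewrite eq_sym => /negbTE ->.
Qed.

Lemma mul_laplacian (u : 'rV[R]_n) j :
  (u *m L) 0 j = \sum_i w i j * (u 0 j - u 0 i).
Proof.
rewrite mxE; under eq_bigr do rewrite laplacianE mulrBr.
under [RHS]eq_bigr do rewrite mulrBr [_ * u 0 j]mulrC [_ * u 0 _]mulrC.
rewrite !sumrB -mulr_sumr; congr (_ - _).
rewrite (bigD1 j) //= eqxx [X in _ + X = _]big1 ?addr0.
  by congr (_ * _); apply: eq_bigr => i _; apply: edge_weight_sym.
by move=> i /negbTE ->; rewrite mulr0.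
Qed.

Lemma dirichlet_form (u : 'rV[R]_n) :
  (\sum_j (u *m L) 0 j * u 0 j) *+ 2
    = \sum_j \sum_i w i j * (u 0 j - u 0 i) ^+ 2.
Proof.
have E : \sum_j (u *m L) 0 j * u 0 j
         = \sum_j \sum_i w i j * (u 0 j - u 0 i) * u 0 j.
  by apply: eq_bigr => j _; rewrite mul_laplacian mulr_suml.
(* The second copy of the form is summed with the two ends exchanged. *)
rewrite mulr2n {1}E E [X in _ + X]exchange_big /= -big_split /=.
apply: eq_bigr => j _; rewrite -big_split /=; apply: eq_bigr => i _.
by rewrite (edge_weight_sym j i); ring.
Qed.

Lemma dirichlet_term_ge0 (u : 'rV[R]_n) i j :
  0 <= w i j * (u 0 j - u 0 i) ^+ 2.
Proof. by rewrite mulr_ge0 ?edge_weight_ge0 ?sqr_ge0. Qed.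

Lemma laplacian_eigenvalue_ge0 (x : R) : eigenvalue L x -> 0 <= x.
Proof.
case/eigenvalueP => u uL u0.
have S_gt0 : 0 < \sum_j u 0 j ^+ 2.
  rewrite lt_def sumr_ge0 ?andbT => [|j _]; last exact: sqr_ge0.
  apply: contraNneq u0 => /eqP.
  rewrite psumr_eq0 => [/allP h|j _]; last exact: sqr_ge0.
  apply/eqP/rowP => j; rewrite mxE; apply/eqP; rewrite -sqrf_eq0.
  exact: h (mem_index_enum j).
have := dirichlet_form u; rewrite uL.
have -> : \sum_j (x *: u) 0 j * u 0 j = x * \sum_j u 0 j ^+ 2.
  by rewrite mulr_sumr; apply: eq_bigr => j _; rewrite mxE expr2 mulrA.
move=> E; rewrite -(pmulr_lge0 _ S_gt0) -(pmulrn_lge0 _ (ltn0Sn 1)) E.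
by do 2!(apply: sumr_ge0 => ? _); apply: dirichlet_term_ge0.
Qed.

Lemma laplacian_ker_const (u : 'rV[R]_n) :
  connected_graph e -> u *m L = 0 -> forall i j, u 0 i = u 0 j.
Proof.
move=> hconn uL.
have edge_eq i j : e i j -> u 0 i = u 0 j.
  move=> eij; have /esym/eqP := dirichlet_form u.
  rewrite uL [X in _ == X *+ 2]big1 ?mul0rn => [|l _]; last first.
    by rewrite mxE mul0r.
  rewrite psumr_eq0 => [/allP/(_ j (mem_index_enum j))/=|l _]; last first.
    by apply: sumr_ge0 => ? _; apply: dirichlet_term_ge0.
  rewrite psumr_eq0 => [/allP/(_ i (mem_index_enum i))/=|l _]; last first.
    exact: dirichlet_term_ge0.
  case: hG => _ _ _ /(_ _ _ eij) bij.
  by rewrite /edge_weight eij mulf_eq0 gt_eqF //= sqrf_eq0 subr_eq0 => /eqP.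
move=> i j; case/connectP: (hconn i j) => s; elim: s i => [|l s IH] i /=.
  by move=> _ ->.
by case/andP => /edge_eq -> /IH h /h.
Qed.

End Dirichlet.

(** * Simplicity of the eigenvalue zero *)

Definition ones_col0 {K : pzSemiRingType} {n : nat} (A : 'M[K]_n.+1) : 'M[K]_n.+1 :=
  \matrix_(i, j) if j == 0 then 1 else A i j.

(** Zero row sums make the sum of the columns of ['X - A] equal to ['X] times
    the column of ones, so adding all columns to the first one exposes the
    factor ['X]. *)
Lemma char_poly_row_sum0 (K : comNzRingType) (n : nat) (A : 'M[K]_n.+1) :
  (forall i, \sum_j A i j = 0) ->
  char_poly A = 'X * \det (ones_col0 (char_poly_mx A)).
Proof.
move=> A0; set C := char_poly_mx A.
(* [T] adds all columns to the first one, [D] scales the first column. *)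
pose T : 'M[{poly K}]_n.+1 := ones_col0 1%:M.
pose D : 'M[{poly K}]_n.+1 :=
  diag_mx (\row_j if j == 0 then 'X else 1).
have detT : \det T = 1.
  rewrite det_trig.
    by rewrite big1 // => i _; rewrite !mxE eqxx; case: ifP.
  apply/is_trig_mxP => i j ij; rewrite !mxE -!val_eqE /= (ltn_eqF ij).
  by case: eqP ij => // ->.
have detD : \det D = 'X.
  rewrite det_diag (bigD1 0) //= mxE eqxx big1 ?mulr1 // => i /negbTE i0.
  by rewrite mxE i0.
have CT : C *m T = ones_col0 C *m D.
  apply/matrixP => i j; rewrite mul_mx_diag [RHS]mxE ![ones_col0 C _ _]mxE.
  rewrite [X in _ = _ * X]mxE mxE; case: (eqVneq j 0) => [->|j0].
    rewrite mul1r; under eq_bigr do rewrite [T _ _]mxE eqxx mulr1 [C _ _]mxE.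
    rewrite big_split /= (bigD1 i) //= mxE eqxx mulr1n [X in _ + X + _]big1 => [|l il].
      under eq_bigr do rewrite !mxE.
      by rewrite sumrN -rmorph_sum A0 rmorph0 subr0 addr0.
    by rewrite mxE eq_sym (negbTE il).
  rewrite mulr1 -[RHS](congr1 (fun M : 'M_n.+1 => M i j) (mulmx1 C)) mxE.
  by apply: eq_bigr => l _; rewrite [T _ _]mxE (negbTE j0).
by rewrite /char_poly -/C -[LHS]mulr1 -detT -det_mulmx CT det_mulmx detD mulrC.
Qed.

Lemma map_ones_col0 (K K' : pzSemiRingType) (f : {rmorphism K -> K'})
    (n : nat) (A : 'M[K]_n.+1) : map_mx f (ones_col0 A) = ones_col0 (map_mx f A).
Proof. by apply/matrixP => i j; rewrite !mxE; case: ifP; rewrite ?rmorph1. Qed.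

Lemma horner_char_poly_mx0 (K : comNzRingType) (n : nat) (A : 'M[K]_n) :
  map_mx (horner_eval 0) (char_poly_mx A) = - A.
Proof.
apply/matrixP => i j; rewrite !mxE /horner_eval !hornerE.
by case: (i == j); rewrite ?mulr1n ?mulr0n !hornerE ?sub0r.
Qed.

Lemma ones_col0_laplacian_unit (R : rcfType) (n : nat) (e : rel 'I_n.+1)
    (b : 'I_n.+1 -> 'I_n.+1 -> R) :
  weighted_graph e b -> connected_graph e ->
  \det (ones_col0 (- laplacian e b)) != 0.
Proof.
move=> hG hconn; set L := laplacian e b.
apply/det0P => -[u u0 uM].
have sum_u : \sum_i u 0 i = 0.
  have /rowP/(_ 0) := uM; rewrite !mxE => uM0; rewrite -[RHS]uM0.
  by apply: eq_bigr => i _; rewrite mxE eqxx mulr1.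
have uLj j : j != 0 -> (u *m L) 0 j = 0.
  move=> j0; have /rowP/(_ j) := uM; rewrite !mxE => uMj.
  apply: oppr_inj; rewrite oppr0 -[RHS]uMj -sumrN; apply: eq_bigr => i _.
  by rewrite [ones_col0 _ _ _]mxE (negbTE j0) [in RHS]mxE mulrN.
(* The column that was replaced is recovered from the zero row sums. *)
have sum_uL : \sum_j (u *m L) 0 j = 0.
  under eq_bigr do rewrite mxE.
  rewrite exchange_big big1 // => i _.
  by rewrite -mulr_sumr laplacian_row_sum0 ?mulr0.
have uL : u *m L = 0.
  apply/rowP => j; rewrite [RHS]mxE; case: (eqVneq j 0) => [->|/uLj //].
  by move: sum_uL; rewrite (bigD1 0) //= big1 ?addr0.
have uc := laplacian_ker_const _ _ _ _ hG u hconn uL.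
case/eqP: u0; apply/rowP => j; rewrite mxE; apply/eqP.
move: sum_u; under eq_bigr do rewrite (uc _ j).
by rewrite sumr_const card_ord => /eqP; rewrite mulrn_eq0.
Qed.

(** If [lambda_2] were nonpositive, [lambda_1] and [lambda_2] would both be [0],
    and ['X ^+ 2] would divide the characteristic polynomial. *)
Lemma laplacian_eigenvalue2_gt0 (R : rcfType) (n : nat) (e : rel 'I_n)
    (b : 'I_n -> 'I_n -> R) (lam : n.-tuple R) :
  (2 <= n)%N -> weighted_graph e b -> connected_graph e ->
  ordered_spectrum (laplacian e b) lam -> 0 < eigenvalue_nb lam 2.
Proof.
case: n e b lam => // n e b lam n2 hG hconn [lam_sorted charL].
have lam_ge0 x : x \in tval lam -> 0 <= x.
  move=> xlam; apply: (laplacian_eigenvalue_ge0 _ _ _ _ hG).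
  by rewrite eigenvalue_root_char charL root_prod_XsubC.
rewrite /eigenvalue_nb ltNge; apply/negP => x1_le0.
have: size lam = n.+1 by rewrite size_tuple.
move: lam_sorted charL lam_ge0 x1_le0.
case: (tval lam) => [|x0 [|x1 s]] /=; first by [].
  by move=> _ _ _ _ [n0]; rewrite -n0 in n2.
case/andP => x01 _ charL lam_ge0 x1_le0 _.
have x1E : x1 = 0.
  by apply/le_anti; rewrite x1_le0 lam_ge0 ?inE ?eqxx ?orbT.
have x0E : x0 = 0 by apply/le_anti; rewrite lam_ge0 ?mem_head // andbT -x1E.
move: charL; rewrite x0E x1E !big_cons subr0.
rewrite char_poly_row_sum0; last by move=> i; apply: laplacian_row_sum0.
move/(mulfI (negbT (polyX_eq0 _)))/(congr1 (horner_eval 0)).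
rewrite -det_map_mx map_ones_col0 horner_char_poly_mx0 /horner_eval !hornerE.
by move/eqP; apply/negP; apply: ones_col0_laplacian_unit.
Qed.

(** * Comparison of the losses *)

Lemma phi_gt0 (R : rcfType) (l gamma k q tau : R) :
  0 < l -> 0 < gamma -> 0 < k -> 0 < q -> 0 < tau -> 0 < phi l gamma k q tau.
Proof.
move=> l0 g0 k0 q0 t0; apply: divr_gt0.
  by rewrite !addr_gt0 ?mulr_gt0 ?exprn_gt0 ?mulr_gt0.
by rewrite addr_gt0 ?mulr_gt0.
Qed.

Lemma convex_combination_lt1 (R : realFieldType) (p c : R) :
  0 < p -> c < 1 -> 1 / (1 + p^-1) + c * (1 / (1 + p)) < 1.
Proof.
move=> p0 c1; have p1 : 0 < 1 + p by rewrite addr_gt0.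
have -> : 1 / (1 + p^-1) + c * (1 / (1 + p)) = (p + c) / (1 + p).
  by field; rewrite !gt_eqF //= addrC.
by rewrite ltr_pdivrMr // mul1r addrC ltrD2r.
Qed.

Theorem proposition4p2 (R : rcfType) (alpha k q tau eps : R)
  (halpha : 0 < alpha) (hk : 0 < k) (hq : 0 < q) (htau : 0 < tau) (heps : 0 < eps)
  (n : nat) (hn : (2 <= n)%N)
  (e : rel 'I_n) (b : 'I_n -> 'I_n -> R)
  (hG : weighted_graph e b) (hconn : connected_graph e)
  (lam : n.-tuple R) (hlam : ordered_spectrum (laplacian e b) lam)
  (gamma : R) (hgamma : 0 < gamma) :
  eps ^+ 2 / eigenvalue_nb lam 2 < gamma ->
  dapi_loss lam alpha k q tau eps gamma < capi_loss n alpha k.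
Proof.
have l2_gt0 := laplacian_eigenvalue2_gt0 _ _ _ _ _ hn hG hconn hlam.
rewrite ltr_pdivrMr // => hthr.
rewrite /dapi_loss /capi_loss ltr_pM2l; last by rewrite divr_gt0 ?mulr_gt0.
have -> : n%:R - 1 = \sum_(2 <= i < n.+1) 1 :> R.
  by rewrite sumr_const_nat subSS natrB // ltnW.
apply: ltr_sum_nat => // i /andP[i2 ilt].
have l2_le : eigenvalue_nb lam 2 <= eigenvalue_nb lam i.
  case: hlam => lam_sorted _; case: i i2 ilt => // i i2 ilt.
  by apply: (sorted_leq_nth le_trans lexx) => //; rewrite inE size_tuple.
have li_gt0 := lt_le_trans l2_gt0 l2_le.
apply: convex_combination_lt1; first exact: phi_gt0.
rewrite ltr_pdivrMr ?mulr_gt0 // mul1r; apply: lt_le_trans hthr _.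
by rewrite ler_pM2l.
Qed.
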